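(* Let $V$ be a set of $n$ vertices and let $\mathcal{G}=\{G_1,\dots,G_k\}$ be a directed evolving graph with $G_i=(V,E_i)$, $E_i\subseteq V\times V$, and let $\mu=\max_i|E_i|$. Consider the following algorithm (Algorithm 1), which computes the edge set $E^*$ of the strict transitive closure of $\mathcal{G}$: (1) for every $v\in V$, set $\mathcal{P}(v)\gets\{v\}$ and $\mathcal{P}^+(v)\gets\emptyset$; (2) for $i=1,\dots,k$: set $U\gets\emptyset$; for each $(u,v)\in E_i$, set $\mathcal{P}^+(v)\gets\mathcal{P}^+(v)\cup\mathcal{P}(u)$ and $U\gets U\cup\{v\}$; then for each $v\in U$, set $\mathcal{P}(v)\gets\mathcal{P}(v)\cup\mathcal{P}^+(v)$ and $\mathcal{P}^+(v)\gets\emptyset$; then scan the vertices $v\in V$, stopping the scan at the first $v$ with $|\mathcal{P}(v)|<|V|$; if no such $v$ exists, halt and return all pairs $(u,v)\in V\times V$ with $u\neq v$; (3) otherwise, after all $k$ steps, return $E^*=\{(u,v): v\in V,\ u\in\mathcal{P}(v)\setminus\{v\}\}$. Assume that set union costs time at most linear in the total number of elements of the two sets involved and that the size of a set is available in constant time. Then Algorithm 1 runs in time $O(k\mu n)$.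
   Context: A strict journey from $u$ to $v$ in $\mathcal{G}$ is a sequence of directed edges $e_1,\dots,e_p$ forming a path from $u$ to $v$ together with indices $i_1<\dots<i_p$ such that $e_j\in E_{i_j}$ for all $j$. The strict transitive closure of $\mathcal{G}$ is the static directed graph $(V,E^* )$ where $(u,v)\in E^*$ iff $u\neq v$ and there is a strict journey from $u$ to $v$. Here $k=|\mathcal{G}|$ is the number of steps and $\mu$ the maximum number of edges present at any single step. *)

(* Defs.v *)
From mathcomp Require Import all_boot.

Set Implicit Arguments.
Unset Strict Implicit.
Unset Printing Implicit Defensive.

(* The i-th step of an evolving graph G : k.-tuple {set V * V} is the edge set
   tnth G i; steps are numbered from 0. *)

Definition max_edges (V : finType) (k : nat) (G : k.-tuple {set V * V}) : nat :=
  \max_(i < k) #|tnth G i|.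

Fixpoint edge_path (V : finType) (u v : V) (es : seq (V * V)) : bool :=
  match es with
  | [::] => u == v
  | e :: es' => (e.1 == u) && edge_path e.2 v es'
  end.

(* all2 also forces es and js to have the same length. *)
Definition strict_journey (V : finType) (k : nat) (G : k.-tuple {set V * V})
    (u v : V) (es : seq (V * V)) (js : seq 'I_k) : Prop :=
  [/\ edge_path u v es,
      sorted (fun i j : 'I_k => i < j) js
    & all2 (fun (e : V * V) (j : 'I_k) => e \in tnth G j) es js].

Definition strict_closure (V : finType) (k : nat) (G : k.-tuple {set V * V})
    (u v : V) : Prop :=
  u != v /\ exists es js, strict_journey G u v es js.

(* The set data structure is left abstract: only the running times of union and
   of cardinality, and the order in which elements are listed, may vary.  All
   other elementary operations take one unit of time. *)
Record machine := Machine {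
  union_time : forall T : finType, {set T} -> {set T} -> nat;
  size_time : forall T : finType, {set T} -> nat;
  elements : forall T : finType, {set T} -> seq T;
  elementsP : forall (T : finType) (A : {set T}),
    perm_eq (elements A) (enum A)
}.

(* The successor accounts for the constant overhead of a union, which is paid
   even when both sets are empty. *)
Definition linear_time_union (M : machine) : Prop :=
  exists c : nat, forall (T : finType) (A B : {set T}),
    union_time M A B <= c * (#|A| + #|B|).+1.

Definition constant_time_size (M : machine) : Prop :=
  exists c : nat, forall (T : finType) (A : {set T}), size_time M A <= c.

(* A value together with the time spent computing it. *)
Definition timed (A : Type) : Type := (A * nat)%type.

Definition ret (A : Type) (a : A) : timed A := (a, 0).

Definition op (A : Type) (a : A) : timed A := (a, 1).

Definition bind (A B : Type) (m : timed A) (f : A -> timed B) : timed B :=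
  ((f m.1).1, m.2 + (f m.1).2).

Notation "x <-- m ;; f" := (bind m (fun x => f))
  (at level 100, m at next level, right associativity).

(* One unit per loop test, including the last, failing one. *)
Fixpoint foreach (T S : Type) (s : seq T) (body : T -> S -> timed S) (st : S)
    : timed S :=
  match s with
  | [::] => op st
  | x :: s' => _ <-- op tt ;; st' <-- body x st ;; foreach s' body st'
  end.

Definition read (V : finType) (a : {ffun V -> {set V}}) (v : V)
    : timed {set V} := op (a v).

Definition write (V : finType) (a : {ffun V -> {set V}}) (v : V) (A : {set V})
    : timed {ffun V -> {set V}} := op [ffun w => if w == v then A else a w].

Definition union (M : machine) (V : finType) (A B : {set V}) : timed {set V} :=
  (A :|: B, union_time M A B).

Definition size_of (M : machine) (V : finType) (A : {set V}) : timed nat :=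
  (#|A|, size_time M A).

Record store (V : finType) := Store {
  Pred : {ffun V -> {set V}};
  PredPlus : {ffun V -> {set V}};
  Upd : {set V}
}.

Section Algorithm.

Variables (M : machine) (V : finType).

Definition vertices : seq V := elements M [set: V].

(* The initial content of the arrays is irrelevant: every cell is overwritten. *)
Definition initialize : timed (store V) :=
  foreach vertices
    (fun v st =>
       A <-- op [set v] ;;
       P <-- write (Pred st) v A ;;
       B <-- op set0 ;;
       Q <-- write (PredPlus st) v B ;;
       ret (Store P Q (Upd st)))
    (Store [ffun=> set0] [ffun=> set0] set0).

Definition process_edge (e : V * V) (st : store V) : timed (store V) :=
  A <-- read (PredPlus st) e.2 ;;
  B <-- read (Pred st) e.1 ;;
  AB <-- union M A B ;;
  Q <-- write (PredPlus st) e.2 AB ;;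
  S <-- op [set e.2] ;;
  U <-- union M (Upd st) S ;;
  ret (Store (Pred st) Q U).

Definition update_vertex (v : V) (st : store V) : timed (store V) :=
  A <-- read (Pred st) v ;;
  B <-- read (PredPlus st) v ;;
  AB <-- union M A B ;;
  P <-- write (Pred st) v AB ;;
  Z <-- op set0 ;;
  Q <-- write (PredPlus st) v Z ;;
  ret (Store P Q (Upd st)).

Definition process_step (E : {set V * V}) (st : store V) : timed (store V) :=
  U0 <-- op set0 ;;
  st1 <-- foreach (elements M E) process_edge
            (Store (Pred st) (PredPlus st) U0) ;;
  foreach (elements M (Upd st1)) update_vertex st1.

Fixpoint scan (s : seq V) (st : store V) : timed bool :=
  match s with
  | [::] => op true
  | v :: s' =>
      _ <-- op tt ;;
      A <-- read (Pred st) v ;;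
      m <-- size_of M A ;;
      b <-- op (m < #|V|) ;;
      if b then ret false else scan s' st
  end.

Definition emit (u v : V) (out : seq (V * V)) : timed (seq (V * V)) :=
  b <-- op (u != v) ;;
  if b then op ((u, v) :: out) else ret out.

Definition return_all : timed (seq (V * V)) :=
  foreach vertices (fun v => foreach vertices (fun u => emit u v)) [::].

Definition return_pred (st : store V) : timed (seq (V * V)) :=
  foreach vertices
    (fun v out =>
       A <-- read (Pred st) v ;;
       foreach (elements M A) (fun u => emit u v) out)
    [::].

Fixpoint main_loop (Es : seq {set V * V}) (st : store V)
    : timed (seq (V * V)) :=
  match Es with
  | [::] => _ <-- op tt ;; return_pred st
  | E :: Es' =>
      _ <-- op tt ;;
      st' <-- process_step E st ;;
      full <-- scan vertices st' ;;
      if full then return_all else main_loop Es' st'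
  end.

Definition algorithm (k : nat) (G : k.-tuple {set V * V})
    : timed (seq (V * V)) :=
  st <-- initialize ;; main_loop G st.

Definition algorithm_output (k : nat) (G : k.-tuple {set V * V})
    : seq (V * V) := (algorithm G).1.

Definition algorithm_time (k : nat) (G : k.-tuple {set V * V}) : nat :=
  (algorithm G).2.

End Algorithm.

(* Main.v *)
Require Import Defs.
From mathcomp Require Import all_boot.
From mathcomp Require Import zify.

Set Implicit Arguments.
Unset Strict Implicit.
Unset Printing Implicit Defensive.

(** Correctness: one step replaces [Pred] by [expand E Pred], and an induction
    on the number of steps, splitting off the last edge of a journey, identifies
    the iterates of [expand] started at singletons with the strict journeys.
    Halting early is harmless because [expand] only enlarges sets.

    Running time: a step costs O(mu n).  Writing the output costs O(n + D), where
    D is the sum of the [#|Pred v|]; initially D = n, and a step changes at most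
    mu of the sets, hence increases D by at most mu n.  This bounds D, and with
    it the cost of the quadratic-looking output of all pairs, by n + k mu n. *)

(** * Values and costs of loops *)

Section Foreach.

Lemma foreach_value (T S : Type) (s : seq T) (body : T -> S -> timed S) (st : S) :
  (foreach s body st).1 = foldl (fun st x => (body x st).1) st s.
Proof. by elim: s st => //= x s IHs st; rewrite IHs. Qed.

(** The bound on the body is uniform in the loop state, so no invariant has to be carried; the
    successors count the loop tests. *)
Lemma foreach_time (T : eqType) (S : Type) (s : seq T)
    (body : T -> S -> timed S) (st : S) (c : T -> nat) :
  (forall x st', x \in s -> (body x st').2 <= c x) ->
  (foreach s body st).2 <= (\sum_(x <- s) (c x).+1).+1.
Proof.
elim: s st => [|x s IHs] st cP /=; first by rewrite big_nil.
rewrite big_cons.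
have := cP x st (mem_head _ _).
have {IHs} := IHs (body x st).1 (fun y st' ys => cP y st' (@mem_behead _ (x :: s) y ys)).
lia.
Qed.

Lemma foreach_time_const (T : eqType) (S : Type) (s : seq T)
    (body : T -> S -> timed S) (st : S) (c : nat) :
  (forall x st', (body x st').2 <= c) ->
  (foreach s body st).2 <= (size s * c.+1).+1.
Proof.
move=> cP; apply: leq_trans (@foreach_time T S s body st (fun=> c) _) _ => //.
by rewrite big_const_seq count_predT iter_addn_0 mulnC.
Qed.

End Foreach.

(** * Enumerations in an arbitrary order *)

Section Elements.

Variable M : machine.

Lemma mem_elements (T : finType) (A : {set T}) : elements M A =i A.
Proof. by move=> x; rewrite (perm_mem (elementsP M A)) mem_enum. Qed.

Lemma size_elements (T : finType) (A : {set T}) : size (elements M A) = #|A|.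
Proof. by rewrite (perm_size (elementsP M A)) cardE. Qed.

Lemma big_elements (T : finType) (A : {set T}) (F : T -> nat) :
  \sum_(x <- elements M A) F x = \sum_(x in A) F x.
Proof. by rewrite (perm_big _ (elementsP M A)) big_enum. Qed.

End Elements.

(** * Effect of the algorithm on the stored sets, and its output *)

Section Values.

Variables (M : machine) (V : finType).
Implicit Types (E : {set V * V}) (P Q : {ffun V -> {set V}}) (st : store V).

(** All sets on the right are taken from the old [P]. This simultaneous update, which the buffer
    [PredPlus] implements, keeps two edges of the same step from being chained, as strictness
    demands. *)
Definition expand E P : {ffun V -> {set V}} :=
  [ffun v => P v :|: \bigcup_(e in E | e.2 == v) P e.1].

Lemma expandP E P u v :
  reflect (u \in P v \/ exists2 w, (w, v) \in E & u \in P w)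
          (u \in expand E P v).
Proof.
rewrite ffunE inE; apply: (iffP orP) => -[uP | ]; try by left.
  by case/bigcupP=> -[w v'] /andP[/= Ee /eqP <-] uw; right; exists w.
by case=> w Ee uw; right; apply/bigcupP; exists (w, v); rewrite //= Ee /=.
Qed.

Lemma sub_foldl_expand (Es : seq {set V * V}) P v :
  P v \subset foldl (fun P E => expand E P) P Es v.
Proof.
elim: Es P => //= E Es IHs P; apply: subset_trans (IHs _).
by apply/subsetP => u uv; apply/expandP; left.
Qed.

Lemma initialize_value :
  (initialize M V).1 = Store [ffun v => [set v]] [ffun=> set0] set0.
Proof.
rewrite /initialize foreach_value /=.
set st0 := Store _ _ _; set f := fun _ _ => _.
have fP s st : foldl f st s =
    Store [ffun v => if v \in s then [set v] else Pred st v]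
          [ffun v => if v \in s then set0 else PredPlus st v] (Upd st).
  elim: s st => [|x s IHs] st /=.
    by case: st => P Q U /=; congr Store; apply/ffunP => v; rewrite ffunE.
  rewrite IHs /=; congr Store; apply/ffunP => v; rewrite !ffunE in_cons;
    by case: (v \in s); rewrite ?orbT ?orbF //; case: eqP => // ->.
rewrite fP; congr Store; apply/ffunP => v;
  by rewrite !ffunE mem_elements inE.
Qed.

Lemma process_edges_value (s : seq (V * V)) st :
  (foreach s (@process_edge M V) st).1 =
  Store (Pred st)
        [ffun v => PredPlus st v :|: \bigcup_(e <- s | e.2 == v) Pred st e.1]
        (Upd st :|: [set e.2 | e in s]).
Proof.
rewrite foreach_value; elim: s st => [|x s IHs] st /=.
  case: st => P Q U /=; congr Store.
    by apply/ffunP => v; rewrite ffunE big_nil setU0.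
  by apply/setP => v; rewrite inE; case: imsetP => [[]|]; rewrite ?orbF.
rewrite IHs /=; congr Store.
  apply/ffunP => v; rewrite !ffunE big_cons eq_sym.
  by case: eqP => [<-|//]; rewrite setUA.
rewrite -setUA; congr (_ :|: _); apply/setP => v; rewrite !inE.
apply/orP/imsetP => [[/eqP ->|/imsetP[e es ->]]|[e]].
- by exists x => //; rewrite mem_head.
- by exists e => //; rewrite in_cons es orbT.
rewrite in_cons => /orP[/eqP ->|es] ->; first by left.
by right; apply/imsetP; exists e.
Qed.

Lemma update_vertices_value (s : seq V) st :
  (foreach s (@update_vertex M V) st).1 =
  Store [ffun v => if v \in s then Pred st v :|: PredPlus st v else Pred st v]
        [ffun v => if v \in s then set0 else PredPlus st v] (Upd st).
Proof.
rewrite foreach_value; elim: s st => [|x s IHs] st /=.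
  by case: st => P Q U /=; congr Store; apply/ffunP => v; rewrite ffunE.
rewrite IHs /=; congr Store; apply/ffunP => v; rewrite !ffunE in_cons;
  case: eqP => [->|] //; case: (x \in s); by rewrite //= setU0.
Qed.

(** Only heads of edges are updated, but at any other vertex the union in [expand] is empty.
    Clearing the buffer at all heads restores the hypothesis for the next step. *)
Lemma process_step_value E st : PredPlus st = [ffun=> set0] ->
  (process_step M E st).1 =
  Store (expand E (Pred st)) [ffun=> set0] [set e.2 | e in E].
Proof.
move=> Q0; rewrite /process_step /bind /= update_vertices_value process_edges_value /=.
have UE : set0 :|: [set e.2 | e in elements M E] = [set e.2 | e in E].
  rewrite set0U; apply/setP => v; apply/imsetP/imsetP => -[e Ee ->];
    by exists e; rewrite // mem_elements in Ee *.
have big0 v : v \notin [set e.2 | e in E] ->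
    \bigcup_(e in E | e.2 == v) Pred st e.1 = set0.
  move=> vE; apply: big_pred0 => e; apply/andP => -[Ee /eqP ev].
  by move: vE; rewrite -ev imset_f.
rewrite {}UE Q0; congr Store; apply/ffunP => v; rewrite !ffunE;
  rewrite (mem_elements M);
  rewrite (perm_big _ (elementsP M E)) big_enum_cond set0U;
  case: ifP => // /negbT /big0 -> //; by rewrite setU0.
Qed.

Lemma scan_value (s : seq V) st :
  (scan M s st).1 = all (fun v => #|V| <= #|Pred st v|) s.
Proof. by elim: s => //= v s IHs; rewrite ltnNge; case: leqP. Qed.

Lemma mem_emit_row (s : seq V) v out p :
  (p \in (foreach s (fun u => emit u v) out).1) =
  (p \in out) || [&& p.1 \in s, p.2 == v & p.1 != p.2].
Proof.
case: p => u w /=; rewrite foreach_value.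
elim: s out => [|x s IHs] out /=; first by rewrite orbF.
rewrite IHs in_cons.
have [->|xv] /= := eqVneq x v.
  by have [->|] /= := eqVneq w v; have [->|] //= := eqVneq u v; rewrite !andbF.
rewrite in_cons xpair_eqE -orbA orbCA; congr (_ || _).
have [->|] //= := eqVneq u x; have [->|] //= := eqVneq w v; rewrite ?andbF //.
Qed.

(** The body is constrained only through its value, so that one statement serves both output
    routines, of which one reads an array cell before each row. *)
Lemma mem_emit_table (r : seq V) (s : V -> seq V)
    (body : V -> seq (V * V) -> timed (seq (V * V))) out p :
  (forall v out', (body v out').1 = (foreach (s v) (fun u => emit u v) out').1) ->
  (p \in (foreach r body out).1) =
  (p \in out) || [&& p.2 \in r, p.1 \in s p.2 & p.1 != p.2].
Proof.
move=> bodyE; rewrite foreach_value.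
elim: r out => [|v r IHr] out /=; first by rewrite orbF.
rewrite IHr bodyE mem_emit_row in_cons -orbA; congr (_ || _).
have [->|] /= := eqVneq p.2 v; last by rewrite andbF.
by case: (v \in r); rewrite ?orbF ?orbb.
Qed.

Lemma mem_return_all p : (p \in (return_all M V).1) = (p.1 != p.2).
Proof.
by rewrite (@mem_emit_table _ (fun=> vertices M V)) // !mem_elements !inE.
Qed.

Lemma mem_return_pred st p :
  (p \in (return_pred M st).1) = (p.1 \in Pred st p.2) && (p.1 != p.2).
Proof.
by rewrite (@mem_emit_table _ (fun v => elements M (Pred st v))) //
  !mem_elements !inE.
Qed.

Lemma all_full st u v :
  all (fun v => #|V| <= #|Pred st v|) (vertices M V) -> u \in Pred st v.
Proof.
move/allP => /(_ v); rewrite mem_elements inE => /(_ isT) full.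
suff -> : Pred st v = [set: V] by rewrite inE.
by apply/eqP; rewrite eqEcard subsetT cardsT.
Qed.

(* Simplification would unfold [process_step] as well. *)
Lemma main_loop_cons E Es st :
  main_loop M (E :: Es) st =
  (let st' := (process_step M E st).1 in
   let b := scan M (vertices M V) st' in
   let out := if b.1 then return_all M V else main_loop M Es st' in
   (out.1, 1 + ((process_step M E st).2 + (b.2 + out.2)))).
Proof. by []. Qed.

Lemma mem_main_loop (Es : seq {set V * V}) st u v : PredPlus st = [ffun=> set0] ->
  ((u, v) \in (main_loop M Es st).1) =
  (u \in foldl (fun P E => expand E P) (Pred st) Es v) && (u != v).
Proof.
elim: Es st => [|E Es IHs] st Q0; first by rewrite mem_return_pred.
rewrite main_loop_cons (process_step_value E Q0); set st' := Store _ _ _; cbv zeta.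
change (?a, ?b).1 with a.
case: ifP => [|_]; last by rewrite IHs.
rewrite scan_value => /(all_full u v) /= uv.
(* A full set stays full through the steps that were skipped. *)
by rewrite mem_return_all (subsetP (sub_foldl_expand Es _ v) _ uv).
Qed.

(** * Strict journeys and iterated expansion *)

Lemma edge_path_rcons (u v : V) es e :
  edge_path u v (rcons es e) = edge_path u e.1 es && (e.2 == v).
Proof. by elim: es u => [|x es IHs] u /=; rewrite ?andbT ?IHs ?andbA 1?(eq_sym u). Qed.

Lemma all2_rcons (S T : Type) (r : S -> T -> bool) s t x y : size s = size t ->
  all2 r (rcons s x) (rcons t y) = all2 r s t && r x y.
Proof.
elim: s t => [|a s IHs] [|b t] //= sz; first by rewrite andbT.
by rewrite IHs ?andbA //; case: sz.
Qed.

Lemma all2_size (S T : Type) (r : S -> T -> bool) s t : all2 r s t -> size s = size t.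
Proof. by elim: s t => [|a s IHs] [|b t] //= /andP[_ /IHs ->]. Qed.

(** Induction on [i]: a journey within the first [i.+1] steps either avoids step [i], or its last
    edge is taken at step [i] and the rest is a journey within the first [i] steps. *)
Lemma journey_prefix k (G : k.-tuple {set V * V}) i u v : i <= k ->
  (u \in foldl (fun P E => expand E P) [ffun v => [set v]] (take i G) v) <->
  exists es js, strict_journey G u v es js /\ all (fun j : 'I_k => j < i) js.
Proof.
elim: i v => [|i IHi] v ik.
  rewrite take0 /= ffunE inE; split=> [/eqP->|[es [js [[p _ a2]]]]].
    by exists [::], [::]; split=> //; split=> //=.
  by case: js es a2 p => [|j js] [|e es].
have Gi : nth set0 G i = tnth G (Ordinal ik) by rewrite (tnth_nth set0).
rewrite (take_nth set0) ?size_tuple // foldl_rcons Gi.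
split=> [/expandP[|[w Ew]]|].
- case/(IHi _ (ltnW ik)) => es [js [jn jsi]]; exists es, js; split=> //.
  by apply: sub_all jsi => j; apply: leqW.
- case/(IHi _ (ltnW ik)) => es [js [[p so a2] jsi]].
  exists (rcons es (w, v)), (rcons js (Ordinal ik)); split; last first.
    by rewrite all_rcons /= ltnSn; apply: sub_all jsi => j; apply: leqW.
  split; rewrite ?edge_path_rcons ?p ?eqxx // ?all2_rcons ?(all2_size a2) ?a2 //.
  case: js so jsi {a2} => //= j js so /andP[ji jsi].
  rewrite rcons_path so /=.
  by have := mem_last j js; rewrite in_cons => /orP[/eqP->|/(allP jsi)].
case=> es [js [[p so a2] jsi]]; apply/expandP.
case/lastP: js so a2 jsi => [|js j] so a2 jsi.
  by left; apply/(IHi _ (ltnW ik)); exists es, [::].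
case/lastP: es p a2 => [|es e] p a2; first by case: (js) a2.
have sz : size es = size js by move/all2_size: a2; rewrite !size_rcons => -[].
have jsj : all (fun j' : 'I_k => j' < j) js.
  have tr : transitive (fun i j : 'I_k => i < j) by move=> ? ? ?; apply: ltn_trans.
  by move: so; rewrite (sorted_pairwise tr) pairwise_rcons => /andP[].
(* By [jsj] the last index [j] is the largest, so comparing it with [i] decides the case. *)
move: jsi; rewrite all_rcons ltnS leq_eqVlt => /andP[/orP[/eqP ji|ji] _]; last first.
  left; apply/(IHi _ (ltnW ik)); exists (rcons es e), (rcons js j); split=> //.
  by rewrite all_rcons ji; apply: sub_all jsj => j' /ltn_trans; apply.
right; exists e.1.
  move: a2 p; rewrite all2_rcons // edge_path_rcons => /andP[_ ej] /andP[_ /eqP<-].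
  by rewrite -surjective_pairing (_ : Ordinal ik = j) //; apply: val_inj.
apply/(IHi _ (ltnW ik)); exists es, js; rewrite -ji; split=> //.
move: p a2; rewrite edge_path_rcons all2_rcons // => /andP[p _] /andP[a2 _].
split=> //; move: so; rewrite -cats1; case: (js) => //= a s.
by rewrite cat_path => /andP[].
Qed.

Lemma mem_algorithm_output k (G : k.-tuple {set V * V}) u v :
  (u, v) \in algorithm_output M G <-> strict_closure G u v.
Proof.
rewrite /algorithm_output /algorithm /= initialize_value mem_main_loop //=.
have := journey_prefix G u v (leqnn k).
rewrite -{1}(size_tuple G) take_size => jP; split.
  by case/andP=> /jP[es [js [jn _]]] uv; split=> //; exists es, js.
case=> uv [es [js jn]]; rewrite uv andbT; apply/jP; exists es, js; split=> //.
by apply/allP => j _.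
Qed.

End Values.

(** * Running time *)

Section Times.

Variables (M : machine) (V : finType) (c d : nat).
Hypothesis unionP : forall (T : finType) (A B : {set T}),
  union_time M A B <= c * (#|A| + #|B|).+1.
Hypothesis sizeP : forall (T : finType) (A : {set T}), size_time M A <= d.
Implicit Types (E : {set V * V}) (P Q : {ffun V -> {set V}}) (st : store V).

Lemma union_time_card (A B : {set V}) : union_time M A B <= c * (#|V| + #|V|).+1.
Proof.
apply: leq_trans (unionP A B) _.
by rewrite leq_mul2l ltnS leq_add ?max_card ?orbT.
Qed.

Lemma size_vertices : size (vertices M V) = #|V|.
Proof. by rewrite size_elements cardsT. Qed.

Lemma initialize_time : (initialize M V).2 <= 5 * #|V| + 1.
Proof. by rewrite mulnC addn1 -size_vertices; apply: foreach_time_const. Qed.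

Lemma process_edge_time (e : V * V) st :
  (process_edge M e st).2 <= 4 + 2 * (c * (#|V| + #|V|).+1).
Proof.
rewrite /process_edge /bind /=.
have := union_time_card (PredPlus st e.2) (Pred st e.1).
have := union_time_card (Upd st) [set e.2].
move: (union_time _ _) (union_time _ _) (c * _) => x y b; lia.
Qed.

Lemma update_vertex_time (v : V) st :
  (update_vertex M v st).2 <= 5 + c * (#|V| + #|V|).+1.
Proof.
rewrite /update_vertex /bind /=.
have := union_time_card (Pred st v) (PredPlus st v).
move: (union_time _ _) (c * _) => x b; lia.
Qed.

(** Both loops make at most [#|E|] rounds, since the updated vertices are the heads of edges in [E].
    The 3 counts the reset of [Upd] and the two failing loop tests; 11 and 3 add up the two loop
    bodies with their tests. *)
Lemma process_step_time E st :
  (process_step M E st).2 <= 3 + #|E| * (11 + 3 * (c * (#|V| + #|V|).+1)).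
Proof.
rewrite /process_step /bind /=; set st0 := Store _ _ _.
have := foreach_time_const (elements M E) st0 process_edge_time.
set st1 := foreach _ _ st0.
have := foreach_time_const (elements M (Upd st1.1)) st1.1 update_vertex_time.
rewrite !size_elements {2}/st1 process_edges_value /= set0U.
have : #|[set e.2 | e in elements M E]| <= #|E|.
  apply: leq_trans (leq_imset_card _ _) _.
  by rewrite (eq_card (mem_elements M E)).
move/(leq_mul (leqnn (5 + c * (#|V| + #|V|).+1).+1)).
move: (c * _) st1.2 (foreach _ _ _).2 #|E| #|[set e.2 | e in _]| => b x y p q; lia.
Qed.

Lemma scan_time (s : seq V) st : (scan M s st).2 <= size s * (3 + d) + 1.
Proof.
elim: s => //= v s IHs; have := sizeP (Pred st v).
by case: ifP => _ /=; lia.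
Qed.

Lemma emit_row_time (s : seq V) v out :
  (foreach s (fun u => emit u v) out).2 <= (size s * 3).+1.
Proof. by apply: foreach_time_const => u out'; rewrite /emit /=; case: ifP. Qed.

Lemma return_all_time : (return_all M V).2 <= (#|V| * (#|V| * 3).+2).+1.
Proof.
rewrite -size_vertices; apply: foreach_time_const => v out.
exact: emit_row_time.
Qed.

Lemma return_pred_time st :
  (return_pred M st).2 <= 3 * (\sum_v #|Pred st v| + #|V|) + 1.
Proof.
apply: leq_trans (foreach_time (c := fun v => (#|Pred st v| * 3).+2) _ _) _.
  move=> v out _ /=; rewrite add1n ltnS -(size_elements M (Pred st v)).
  exact: emit_row_time.
rewrite big_elements addn1 ltnS (eq_bigl predT) => [|v]; last by rewrite inE.
rewrite -sum1_card -big_split big_distrr /=.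
by apply: leq_sum => v _; move: #|_| => p; lia.
Qed.

(** Each edge is charged to its head, whose set it enlarges by at most [#|V|] elements. *)
Lemma sum_card_expand E P :
  \sum_v #|expand E P v| <= \sum_v #|P v| + #|E| * #|V|.
Proof.
rewrite -sum1_card big_distrl /= (partition_big snd predT) //= -big_split /=.
apply: leq_sum => v _; rewrite ffunE; apply: leq_trans (leq_card_setU _ _) _.
rewrite leq_add2l; apply: (big_ind2 (fun (A : {set V}) m => #|A| <= m)).
- by rewrite cards0.
- by move=> A m B p Am Bp; apply: leq_trans (leq_card_setU _ _) (leq_add Am Bp).
- by move=> e _; rewrite mul1n max_card.
Qed.

(** The sum of the [#|Pred st v|] acts as a potential that pays for the output in advance. A step
    raises it by at most [m * #|V|], and the per-step term covers five times this increase along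
    with the work of the step. *)
Lemma main_loop_time (m : nat) (Es : seq {set V * V}) st :
  0 < m -> 0 < #|V| -> (forall E, E \in Es -> #|E| <= m) ->
  PredPlus st = [ffun=> set0] ->
  (main_loop M Es st).2 <= 5 * (\sum_v #|Pred st v| + #|V|)
    + size Es * ((9 * c + d + 30) * (m * #|V|)).
Proof.
move=> m0 V0; elim: Es st => [|E Es IHs] st EsP Q0.
  change (main_loop M [::] st).2 with (1 + (return_pred M st).2).
  have := return_pred_time st; move: V0 (return_pred M st).2 => /=.
  by move: #|V| (\sum_v _) => n D n0 x; lia.
have Em : #|E| <= m by apply: EsP; rewrite mem_head.
have {}IHs st' := IHs st' (fun F FEs => EsP F (@mem_behead _ (E :: Es) F FEs)).
have := process_step_time E st; have := scan_time (vertices M V) (process_step M E st).1.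
rewrite main_loop_cons (process_step_value M E Q0); set st' := Store _ _ _; cbv zeta.
change (?a, ?b).2 with b; rewrite size_vertices.
have D' : \sum_v #|Pred st' v| <= \sum_v #|Pred st v| + m * #|V|.
  apply: leq_trans (sum_card_expand E (Pred st)) _.
  by rewrite leq_add2l leq_mul2r Em orbT.
set out := if _ then _ else _.
have out_time : out.2 <= 5 * (\sum_v #|Pred st' v| + #|V|)
    + size Es * ((9 * c + d + 30) * (m * #|V|)).
  rewrite /out; case: ifP => [full|_]; last exact: IHs.
  (* With n vertices and all sets full, the potential is n^2, so the 3n^2 + 2n + 1 units for listing
     all pairs fit into 5(n^2 + n). *)
  have -> : \sum_v #|Pred st' v| = #|V| * #|V|.
    rewrite -sum_nat_const; apply: eq_bigr => v _; apply/eqP.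
    rewrite eqn_leq max_card; move: full; rewrite scan_value => /allP; apply.
    by rewrite mem_elements inE.
  have := return_all_time; move: (return_all M V).2 (size Es * _) V0.
  by move: #|V| => n x r n0; lia.
move: out_time D'; rewrite [size (_ :: _)]/= (mulSn (size Es)).
(* For n > 0, 2n + 1 is at most 3n; this is where [9 * c] comes from. *)
have : #|E| * (11 + 3 * (c * (#|V| + #|V|).+1)) <= m * #|V| * (11 + 9 * c).
  rewrite -mulnA leq_mul //; have := leq_pmulr c V0.
  by move: V0; move: #|V| => n n0; lia.
(* The scan may visit every vertex even when the step has few edges; [0 < m] absorbs this. *)
have : #|V| * (3 + d) <= m * #|V| * (3 + d) by rewrite leq_mul2r leq_pmull ?orbT.
have : 0 < m * #|V| by rewrite muln_gt0 m0.
move: (\sum_v #|Pred st' v|) (\sum_v #|Pred st v|) out.2 (size Es * _) => D1 D0 x r.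
move: (process_step M E st).2 (scan _ _ _).2 (#|E| * _) => y z w.
move: #|V| (#|V| * (3 + d)) (m * #|V|) => n t q; lia.
Qed.

(** Initialization costs 5n + 1, and the initial potential term is 5(n + n). Together they are at
    most 16n, hence at most 16 times the target product, which gives 46 = 30 + 16. *)
Lemma algorithm_time_bound k (G : k.-tuple {set V * V}) : 0 < max_edges G ->
  algorithm_time M G <= (9 * c + d + 46) * (k * max_edges G * #|V|).
Proof.
move=> m0.
have Gm i : #|tnth G i| <= max_edges G by apply: leq_bigmax.
(* A positive maximum yields an actual edge, hence at least one step and one vertex. *)
have [i ei] : exists i, 0 < #|tnth G i|.
  apply/existsP; apply: contraLR m0 => /existsPn G0.
  by rewrite -leqNgt; apply/bigmax_leqP => i _; rewrite leqNgt G0.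
have k0 : 0 < k by apply: leq_trans (ltn_ord i).
have V0 : 0 < #|V| by case/card_gt0P: ei => -[v _] _; apply/card_gt0P; exists v.
rewrite /algorithm_time /algorithm /bind; change (?a, ?b).2 with b.
rewrite initialize_value.
have := @main_loop_time (max_edges G) G
  (Store [ffun v => [set v]] [ffun=> set0] set0) m0 V0 _ erefl.
rewrite size_tuple /= (eq_bigr (fun=> 1)) => [|v _]; last by rewrite ffunE cards1.
have GM E : E \in G -> #|E| <= max_edges G by case/tnthP => j ->; apply: Gm.
rewrite sum1_card => /(_ GM); have := initialize_time.
have : #|V| <= k * (max_edges G * #|V|).
  by rewrite mulnA leq_pmull // muln_gt0 k0.
rewrite -mulnA [k * (_ * (_ * _))]mulnCA.
move: (initialize M V).2 (main_loop _ _ _).2 => x y.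
move: V0; move: #|V| (k * _) => n q n0; lia.
Qed.

End Times.

Theorem theorem1 (M : machine) :
  linear_time_union M -> constant_time_size M ->
  (forall (V : finType) (k : nat) (G : k.-tuple {set V * V}) (u v : V),
     ((u, v) \in algorithm_output M G) <-> strict_closure G u v) /\
  (exists C : nat, forall (V : finType) (k : nat) (G : k.-tuple {set V * V}),
     0 < max_edges G ->
     algorithm_time M G <= C * (k * max_edges G * #|V|)).
Proof.
move=> [c unionP] [d sizeP]; split; first by move=> *; apply: mem_algorithm_output.
by exists (9 * c + d + 46) => V k G; apply: algorithm_time_bound.
Qed.
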